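(* Let $X$ be a locally compact and locally connected Hausdorff topological space. Then the group $H_2(X)$ of invertible continuous binary operations on $X$ is isomorphic, algebraically and topologically, to the group $C(X,H(X))$; that is, there is a group isomorphism $C(X,H(X))\to H_2(X)$ which is also a homeomorphism.
   Context: For topological spaces $Y,Z$, $C(Y,Z)$ denotes the space of all continuous maps $Y\to Z$ with the compact-open topology, generated by the subbase of sets $W(K,U)=\{f: f(K)\subset U\}$ with $K\subset Y$ compact and $U\subset Z$ open. All spaces of maps carry the compact-open topology. $H(X)$ is the group of all homeomorphisms of $X$ onto itself under composition, with the compact-open topology (as a subspace of $C(X,X)$); for $X$ locally compact, locally connected and Hausdorff it is a topological group. The group operation on $C(X,H(X))$ is pointwise: $(fg)(t)=f(t)\circ g(t)$ for $t\in X$. A continuous binary operation on $X$ is a continuous map $f:X^2=X\times X\to X$. The composition of two continuous binary operations $f,\varphi$ is $(f\circ\varphi)(t,x)=f(t,\varphi(t,x))$. With this composition the set $C_2(X)$ of all continuous binary operations on $X$ is a monoid with identity element $e(t,x)=x$. An element $f\in C_2(X)$ is invertible if there exists $f^{-1}\in C_2(X)$ with $f\circ f^{-1}=f^{-1}\circ f=e$. $H_2(X)$ is the group of all invertible elements of $C_2(X)$, with the compact-open topology (as a subspace of $C(X^2,X)$). *)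

(* Defs.v *)
From HB Require Import structures.
From mathcomp Require Import all_boot all_classical.
From mathcomp Require Import topology function_spaces.

Set Implicit Arguments.
Unset Strict Implicit.
Unset Printing Implicit Defensive.

Local Open Scope classical_set_scope.
Local Open Scope group_scope.

(* Makes the compact-open topology the canonical one on [continuousType Y Z]. *)
Export ArrowAsCompactOpen.

Definition locally_connected (T : topologicalType) : Prop :=
  forall (x : T) (U : set T), nbhs x U ->
    exists V : set T, [/\ open_nbhs x V, connected V & V `<=` U].

Definition homeomorphism {Y Z : topologicalType} (f : Y -> Z) : Prop :=
  continuous f /\
  exists g : Z -> Y, [/\ continuous g, cancel f g & cancel g f].

HB.mixin Record isTopologicalGroup G of Group G & Topological G := {
  mulg_continuous : continuous (fun p : G * G => p.1 * p.2) ;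
  invg_continuous : continuous (fun x : G => x^-1)
}.

#[short(type="topologicalGroupType")]
HB.structure Definition TopologicalGroup :=
  {G of isTopologicalGroup G & Group G & Topological G}.

Section pointwise_group.
Context (Y : topologicalType) (G : topologicalGroupType).
Implicit Types f g h : continuousType Y G.

Fact cmul_subproof f g : continuous (fun t => f t * g t).
Proof.
move=> t; apply: (@continuous_comp _ _ _ (fun t => (f t, g t))
  (fun p : G * G => p.1 * p.2)); last exact: mulg_continuous.
by apply: cvg_pair; exact: cts_fun.
Qed.

Fact cinv_subproof f : continuous (fun t => (f t)^-1).
Proof.
move=> t; apply: (@continuous_comp _ _ _ f (fun x : G => x^-1)).
  exact: cts_fun.
exact: invg_continuous.
Qed.

Definition cone : continuousType Y G := cst 1.
Definition cmul f g : continuousType Y G := mkcts (@cmul_subproof f g).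
Definition cinv f : continuousType Y G := mkcts (@cinv_subproof f).

Fact cmulA : associative cmul.
Proof. by move=> f g h; apply/continuousEP => t /=; exact: mulgA. Qed.
Fact cmul1 : left_id cone cmul.
Proof. by move=> f; apply/continuousEP => t /=; exact: mul1g. Qed.
Fact c1mul : right_id cone cmul.
Proof. by move=> f; apply/continuousEP => t /=; exact: mulg1. Qed.
Fact cmulV : left_inverse cone cinv cmul.
Proof. by move=> f; apply/continuousEP => t /=; exact: mulVg. Qed.
Fact cVmul : right_inverse cone cinv cmul.
Proof. by move=> f; apply/continuousEP => t /=; exact: mulgV. Qed.

HB.instance Definition _ := isGroup.Build (continuousType Y G)
  cmulA cmul1 c1mul cmulV cVmul.

End pointwise_group.

(* As a [set_type], [homeo X] carries the topology induced by the compact-open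
   topology of [continuousType X X]. *)
Definition homeo (X : topologicalType) : Type :=
  set_type [set f : continuousType X X | homeomorphism f].

HB.instance Definition _ (X : topologicalType) :=
  Topological.copy (homeo X)
    (set_type [set f : continuousType X X | homeomorphism f]).

Section homeo_group.
Context (X : topologicalType).
Implicit Types f g h : homeo X.

Definition homeo_fun f : continuousType X X := set_val f.

Lemma homeo_inj f g : homeo_fun f =1 homeo_fun g -> f = g.
Proof. by move=> fg; apply: val_inj; apply/continuousEP. Qed.

Lemma homeoP f : homeomorphism (homeo_fun f).
Proof. exact: (set_valP f). Qed.

Definition mkhomeo (f : continuousType X X) (hf : homeomorphism f) : homeo X :=
  exist _ f (mem_set hf).

Definition homeo_invfun f : X -> X := projT1 (cid (homeoP f).2).

Lemma homeo_invfun_continuous f : continuous (homeo_invfun f).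
Proof. by rewrite /homeo_invfun; case: cid => g []. Qed.
Lemma homeo_funK f : cancel (homeo_fun f) (homeo_invfun f).
Proof. by rewrite /homeo_invfun; case: cid => g []. Qed.
Lemma homeo_invfunK f : cancel (homeo_invfun f) (homeo_fun f).
Proof. by rewrite /homeo_invfun; case: cid => g []. Qed.

Fact homeo_one_subproof : homeomorphism (idfun : X -> X).
Proof. by split; [exact: cts_fun | exists idfun; split=> //; exact: cts_fun]. Qed.

Fact homeo_mul_subproof f g : homeomorphism (homeo_fun f \o homeo_fun g).
Proof.
split; first exact: cts_fun.
exists (homeo_invfun g \o homeo_invfun f); split.
- by move=> x; apply: continuous_comp; exact: homeo_invfun_continuous.
- by move=> x /=; rewrite !homeo_funK.
- by move=> x /=; rewrite !homeo_invfunK.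
Qed.

Fact homeo_inv_subproof f :
  homeomorphism (mkcts (@homeo_invfun_continuous f)).
Proof.
split; first exact: homeo_invfun_continuous.
exists (homeo_fun f); split; first exact: cts_fun.
- exact: homeo_invfunK.
- exact: homeo_funK.
Qed.

Definition homeo_one : homeo X := mkhomeo homeo_one_subproof.
Definition homeo_mul f g : homeo X := mkhomeo (homeo_mul_subproof f g).
Definition homeo_inv f : homeo X := mkhomeo (homeo_inv_subproof f).

Fact homeo_mulA : associative homeo_mul.
Proof. by move=> f g h; exact: homeo_inj. Qed.
Fact homeo_mul1 : left_id homeo_one homeo_mul.
Proof. by move=> f; exact: homeo_inj. Qed.
Fact homeo_1mul : right_id homeo_one homeo_mul.
Proof. by move=> f; exact: homeo_inj. Qed.
Fact homeo_mulV : left_inverse homeo_one homeo_inv homeo_mul.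
Proof. by move=> f; apply: homeo_inj => x; exact: homeo_funK. Qed.
Fact homeo_Vmul : right_inverse homeo_one homeo_inv homeo_mul.
Proof. by move=> f; apply: homeo_inj => x; exact: homeo_invfunK. Qed.

HB.instance Definition _ := isGroup.Build (homeo X)
  homeo_mulA homeo_mul1 homeo_1mul homeo_mulV homeo_Vmul.

End homeo_group.

(* For X locally compact, locally connected and Hausdorff, homeo X is a
   topological group; local connectedness is needed for the continuity of the
   inversion. *)
Section homeo_topological_group.
Context (X : topologicalType).

Lemma homeo_val_continuous : continuous (@homeo_fun X).
Proof. exact: initial_continuous. Qed.

Lemma homeo_subbase_open (K O : set X) : compact K -> open O ->
  open [set g : homeo X | homeo_fun g @` K `<=` O].
Proof.
move=> cK oO.
exists [set g : continuousType X X | (g : X -> X) @` K `<=` O] => //.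
by exists [set g : X -> X | g @` K `<=` O] => //; exact: compact_open_open.
Qed.

Lemma continuous_homeo (T : topologicalType) (F : T -> homeo X) :
  continuous (fun t => homeo_fun (F t)) -> continuous F.
Proof. exact: continuous_comp_initial. Qed.

Lemma continuous_homeoP (T : topologicalType) (F : T -> homeo X) :
  (forall (t : T) (K O : set X), compact K -> open O ->
     homeo_fun (F t) @` K `<=` O ->
     \forall s \near t, homeo_fun (F s) @` K `<=` O) ->
  continuous F.
Proof.
move=> FP; apply: continuous_homeo; apply: continuous_comp_initial => t.
by apply/compact_open_cvgP => K O; exact: FP.
Qed.

Hypothesis lcX : locally_compact [set: X].
Hypothesis hX : hausdorff_space X.

Lemma locally_compact_hausdorff_regular : regular_space X.
Proof.
move=> x; have [B] := @lcX x I; rewrite withinET => Bx [cB _].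
exact: (compact_regular _ cB).
Qed.

Fact homeo_mul_continuous :
  continuous (fun p : homeo X * homeo X => p.1 * p.2).
Proof.
apply: continuous_homeo => p.
apply: (@continuous_comp _ _ _
  (fun p : homeo X * homeo X => (homeo_fun p.1, homeo_fun p.2))
  (uncurry (comp : continuousType X X -> continuousType X X ->
                   continuousType X X))); last first.
  by apply: compose_continuous => //; exact: locally_compact_hausdorff_regular.
have c1 : homeo_fun q.1 @[q --> p] --> homeo_fun p.1.
  by apply: (@cvg_comp _ _ _ fst); [exact: cvg_fst|exact: homeo_val_continuous].
have c2 : homeo_fun q.2 @[q --> p] --> homeo_fun p.2.
  by apply: (@cvg_comp _ _ _ snd); [exact: cvg_snd|exact: homeo_val_continuous].
exact: cvg_pair c1 c2.
Qed.

Hypothesis lcnX : locally_connected X.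

Fact homeo_inv_continuous : continuous (fun f : homeo X => f^-1).
Proof.
have regX := locally_compact_hausdorff_regular.
apply: continuous_homeoP => f K U cK oU fKU.
suff : \forall g \near f, K `<=` [set y | U (homeo_invfun g y)].
  by apply: filterS => g gKU _ [y Ky <-]; exact: gKU.
have KP : near_covering K by exact/compact_near_coveringP.
apply: (KP _ (nbhs f) (fun g y => U (homeo_invfun g y))) => y Ky.
pose x := homeo_invfun f y.
have fx : homeo_fun f x = y by exact: homeo_invfunK.
have Ux : nbhs x U by apply: open_nbhs_nbhs; split=> //; apply: fKU; exists y.
have [B] := @lcX x I; rewrite withinET => Bx [cB clB].
have [R Rx RU] := regX x U Ux.
pose O := (R `&` B)^°.
have Ox : O x by apply: nbhs_singleton; apply: nbhs_interior; exact: filterI.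
have oO : open O by exact: open_interior.
have OU : O `<=` U.
  by move=> z /interior_subset[Rz _]; apply: RU; exact: subset_closure.
pose D := closure O `&` ~` O.
have cD : compact D.
  apply: (subclosed_compact _ cB).
    by apply: closedI; [exact: closed_closure | exact: open_closedC].
  move=> z [cOz _]; rewrite (iffLR (closure_id B) clB).
  by apply: closureS cOz => w /interior_subset[].
have fOy : nbhs y [set z | O (homeo_invfun f z)].
  apply: (@homeo_invfun_continuous _ f y); exact: open_nbhs_nbhs.
have [S Sy SO] := regX y _ fOy.
have [V [[oV Vy] conV VS]] := lcnX Sy.
pose N := [set g : homeo X | homeo_fun g @` D `<=` ~` closure V] `&`
          [set g : homeo X | homeo_fun g @` [set x] `<=` V].
exists (V, N) => /=.
  split; first exact: open_nbhs_nbhs.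
  apply: open_nbhs_nbhs; split.
    apply: openI; apply: homeo_subbase_open => //; last exact: compact_set1.
    by apply: closed_openC; exact: closed_closure.
  split=> _ [z Dz <-]; last by rewrite Dz fx.
  move=> clV; case: Dz => _; apply.
  by rewrite -(homeo_funK f z); apply: SO; exact: closureS clV.
case=> z g /= [Vz [gD gx]]; apply: OU.
have ginvc := @homeo_invfun_continuous _ g.
suff VE : V `&` [set w | O (homeo_invfun g w)] = V by move: Vz; rewrite -VE => -[].
apply: conV.
- exists (homeo_fun g x); split; first by apply: gx; exists x.
  by rewrite /= homeo_funK.
- exists [set w | O (homeo_invfun g w)] => //.
  exact: (open_comp (fun w _ => ginvc w)).
- exists [set w | closure O (homeo_invfun g w)].
    by apply: (closed_comp (fun w _ => ginvc w)); exact: closed_closure.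
  apply/seteqP; split=> w [Vw /= Ow]; split=> //=; first exact: subset_closure.
  apply: contrapT => nOw; apply: (gD w); last exact: subset_closure.
  by exists (homeo_invfun g w); [split | exact: homeo_invfunK].
Qed.

Definition homeo_topologicalGroup : topologicalGroupType :=
  HB.pack (homeo X)
    (isTopologicalGroup.Build (homeo X)
       homeo_mul_continuous homeo_inv_continuous).

End homeo_topological_group.

Definition binop (X : topologicalType) : Type := continuousType (X * X)%type X.

HB.instance Definition _ (X : topologicalType) :=
  Topological.copy (binop X) (continuousType (X * X)%type X).

Section binop_monoid.
Context (X : topologicalType).
Implicit Types f g h : binop X.

Definition binop_fun f : continuousType (X * X)%type X := f.

Lemma binop_inj f g : binop_fun f =1 binop_fun g -> f = g.
Proof. by move=> /continuousEP. Qed.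

Fact binop_comp_subproof f g :
  continuous (fun p : X * X => binop_fun f (p.1, binop_fun g p)).
Proof.
move=> p; apply: (@continuous_comp _ _ _ (fun p => (p.1, binop_fun g p))
  (binop_fun f)); last exact: cts_fun.
by apply: cvg_pair; [exact: cvg_fst | exact: cts_fun].
Qed.

Fact binop_id_subproof : continuous (fun p : X * X => p.2).
Proof. by move=> p; exact: cvg_snd. Qed.

Definition binop_comp f g : binop X := mkcts (@binop_comp_subproof f g).
Definition binop_id : binop X := mkcts binop_id_subproof.

Fact binop_compA : associative binop_comp.
Proof. by move=> f g h; exact: binop_inj. Qed.
Fact binop_id_comp : left_id binop_id binop_comp.
Proof. by move=> f; exact: binop_inj. Qed.
Fact binop_comp_id : right_id binop_id binop_comp.
Proof. by move=> f; apply: binop_inj => -[]. Qed.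

HB.instance Definition _ := isMonoid.Build (binop X)
  binop_compA binop_id_comp binop_comp_id.

End binop_monoid.

Definition binop_invertible (X : topologicalType) : set (binop X) :=
  [set f | exists g : binop X, f * g = 1 /\ g * f = 1].

Definition invbinop (X : topologicalType) : Type :=
  set_type (@binop_invertible X).

HB.instance Definition _ (X : topologicalType) :=
  Topological.copy (invbinop X) (set_type (@binop_invertible X)).

Section invbinop_group.
Context (X : topologicalType).
Implicit Types f g h : invbinop X.

Definition invbinop_val f : binop X := set_val f.

Lemma invbinop_inj : injective invbinop_val.
Proof. exact: val_inj. Qed.

Lemma invbinopP f :
  exists g : binop X, invbinop_val f * g = 1 /\ g * invbinop_val f = 1.
Proof. exact: (set_valP f). Qed.

Definition mkinvbinop (f : binop X) (hf : binop_invertible f) : invbinop X :=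
  exist _ f (mem_set hf).

Definition invbinop_invval f : binop X := projT1 (cid (invbinopP f)).

Lemma invbinop_valV f : invbinop_val f * invbinop_invval f = 1.
Proof. by rewrite /invbinop_invval; case: cid => g []. Qed.
Lemma invbinop_Vval f : invbinop_invval f * invbinop_val f = 1.
Proof. by rewrite /invbinop_invval; case: cid => g []. Qed.

Fact invbinop_one_subproof : binop_invertible (1 : binop X).
Proof. by exists 1; rewrite mulg1. Qed.

Fact invbinop_mul_subproof f g :
  binop_invertible (invbinop_val f * invbinop_val g).
Proof.
exists (invbinop_invval g * invbinop_invval f); split.
  by rewrite mulgA -(mulgA (invbinop_val f)) invbinop_valV mulg1 invbinop_valV.
by rewrite mulgA -(mulgA (invbinop_invval g)) invbinop_Vval mulg1 invbinop_Vval.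
Qed.

Fact invbinop_inv_subproof f : binop_invertible (invbinop_invval f).
Proof.
by exists (invbinop_val f); rewrite invbinop_valV invbinop_Vval.
Qed.

Definition invbinop_one : invbinop X := mkinvbinop invbinop_one_subproof.
Definition invbinop_mul f g : invbinop X :=
  mkinvbinop (invbinop_mul_subproof f g).
Definition invbinop_inv f : invbinop X := mkinvbinop (invbinop_inv_subproof f).

Fact invbinop_mulA : associative invbinop_mul.
Proof. by move=> f g h; apply: invbinop_inj; exact: mulgA. Qed.
Fact invbinop_mul1 : left_id invbinop_one invbinop_mul.
Proof. by move=> f; apply: invbinop_inj; exact: mul1g. Qed.
Fact invbinop_1mul : right_id invbinop_one invbinop_mul.
Proof. by move=> f; apply: invbinop_inj; exact: mulg1. Qed.
Fact invbinop_mulV : left_inverse invbinop_one invbinop_inv invbinop_mul.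
Proof. by move=> f; apply: invbinop_inj; exact: invbinop_Vval. Qed.
Fact invbinop_Vmul : right_inverse invbinop_one invbinop_inv invbinop_mul.
Proof. by move=> f; apply: invbinop_inj; exact: invbinop_valV. Qed.

HB.instance Definition _ := isGroup.Build (invbinop X)
  invbinop_mulA invbinop_mul1 invbinop_1mul invbinop_mulV invbinop_Vmul.

End invbinop_group.

(* Main.v *)
(* The isomorphism [Phi f (t, x) = f t x] is the exponential law between
   [C(X, C(X, X))] and [C(X * X, X)], a homeomorphism because [X] is locally
   compact Hausdorff, restricted to the maps with values in [homeo X].  These
   correspond exactly to the invertible operations: [Phi f^-1] is inverse to
   [Phi f], and is jointly continuous because inversion in [homeo X] is
   continuous, by local connectedness. *)
Require Import Defs.
From mathcomp Require Import all_boot all_classical.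
From mathcomp Require Import topology function_spaces.

Local Open Scope classical_set_scope.

(** Postcomposition with [q] pulls the subbasic set $W(K,O)$ back to $W(K,q^{-1}(O))$. *)
Lemma compact_open_postcomp_continuous (Y Z W : topologicalType) (q : Z -> W) :
  continuous q -> continuous (fun f : Y -> Z => q \o f).
Proof.
move=> cq f; apply/compact_open_cvgP.
  by apply: fmap_filter; exact: nbhs_filter.
move=> K O cK oO fKO.
have oqO : open (q @^-1` O) by apply: open_comp oO => z _; exact: cq.
have qfK : [set g : Y -> Z | g @` K `<=` q @^-1` O] f.
  by move=> _ [y Ky <-]; apply: fKO; exists y.
apply: filterS (open_nbhs_nbhs (conj (compact_open_open cK oqO) qfK)).
by move=> g gK _ [y Ky <-]; apply: gK; exists y.
Qed.

(** If [Z] has the initial topology along [q], every $W(K,q^{-1}(O'))$ is the preimage of $W(K,O')$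
    under postcomposition with [q], so continuity can be tested after applying [q]. *)
Lemma compact_open_continuous_initial (A Y Z W : topologicalType) (q : Z -> W)
    (F : A -> Y -> Z) :
  (forall O : set Z, open O -> exists2 O' : set W, open O' & q @^-1` O' = O) ->
  continuous (fun a => q \o F a) -> continuous F.
Proof.
move=> qO cqF a; apply/compact_open_cvgP => K O cK /qO[O' oO' <-] FKO.
have qFK : [set g : Y -> W | g @` K `<=` O'] (q \o F a).
  by move=> _ [y Ky <-]; apply: (FKO (F a y)); exists y.
have nF := cqF a _ (open_nbhs_nbhs (conj (compact_open_open cK oO') qFK)).
by apply: (@filterS _ (nbhs a)) nF => b bK _ [y Ky <-]; apply: bK; exists y.
Qed.

Lemma homeo_open_preimage (X : topologicalType) (O : set (homeo X)) :
  open O -> exists2 O' : set (X -> X),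
    open O' & (fun f => homeo_fun f : X -> X) @^-1` O' = O.
Proof. by move=> [_ [O' oO' <-] <-]; exists O'. Qed.

Section exponential_law.
Context (X : topologicalType).
Hypotheses (lcX : locally_compact [set: X]) (hX : hausdorff_space X)
  (lcnX : locally_connected X).

Let G := homeo_topologicalGroup lcX hX lcnX.
Let regX : regular_space X := locally_compact_hausdorff_regular lcX hX.

Lemma homeo_arrow_continuous : continuous (fun f : G => homeo_fun f : X -> X).
Proof.
move=> f; apply: (@continuous_comp _ _ _ (@homeo_fun X)
  (fun g : continuousType X X => g : X -> X)).
  exact: homeo_val_continuous.
exact: initial_continuous.
Qed.

Lemma cts_homeo_arrow_continuous (f : continuousType X G) :
  continuous (fun t => homeo_fun (f t) : X -> X).
Proof.
move=> t; apply: (@continuous_comp _ _ _ f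
  (fun g : G => homeo_fun g : X -> X)); first exact: cts_fun.
exact: homeo_arrow_continuous.
Qed.

(** Local compactness and regularity of [X] turn continuity of $t \mapsto f(t)$ in the compact-open
    topology into joint continuity. *)
Fact binop_of_cts_subproof (f : continuousType X G) :
  continuous (uncurry (fun t => homeo_fun (f t) : X -> X)).
Proof.
apply: (continuous_uncurry_regular lcX regX (@cts_homeo_arrow_continuous f)).
by move=> t; exact: cts_fun.
Qed.

Definition binop_of_cts (f : continuousType X G) : binop X :=
  mkcts (@binop_of_cts_subproof f).

(** At each fixed [t], composing operations is composing the maps $f(t)$ and $g(t)$. *)
Lemma binop_of_cts_mul f g :
  binop_of_cts (f * g)%g = (binop_of_cts f * binop_of_cts g)%g.
Proof. by apply: binop_inj => -[]. Qed.

Lemma binop_of_cts_one : binop_of_cts 1%g = 1%g.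
Proof. by apply: binop_inj => -[]. Qed.

Fact invbinop_of_cts_subproof f : binop_invertible (binop_of_cts f).
Proof.
exists (binop_of_cts f^-1%g).
by rewrite -!binop_of_cts_mul mulgV mulVg binop_of_cts_one.
Qed.

Definition invbinop_of_cts (f : continuousType X G) : invbinop X :=
  mkinvbinop (invbinop_of_cts_subproof f).

Lemma invbinop_of_cts_continuous : continuous invbinop_of_cts.
Proof.
(* Two initial topologies are unfolded: the subspace [invbinop X], then continuous maps inside all
   functions. What remains is uncurrying, continuous at points [f] that are jointly continuous. *)
apply: continuous_comp_initial; apply: continuous_comp_initial => f.
apply: (@continuous_comp _ _ _
  (fun (f : continuousType X G) t => homeo_fun (f t) : X -> X)
  (uncurry : (X -> X -> X) -> (X * X -> X))); last first.
  apply: uncurry_continuous => //; first exact: cts_homeo_arrow_continuous.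
  by move=> t; exact: cts_fun.
apply: (@continuous_comp _ _ _ (fun f : continuousType X G => f : X -> G)
  (fun f : X -> G => (fun g : G => homeo_fun g : X -> X) \o f)).
  exact: initial_continuous.
exact/compact_open_postcomp_continuous/homeo_arrow_continuous.
Qed.

Fact invbinop_section_subproof (b : invbinop X) (t : X) :
  continuous (curry (binop_fun (invbinop_val b)) t).
Proof. exact: (continuous_curry (@cts_fun _ _ (invbinop_val b))).2. Qed.

Fact invbinop_section_homeo_subproof b t :
  homeomorphism (mkcts (@invbinop_section_subproof b t)).
Proof.
split; first exact: cts_fun.
(* The section of the inverse operation at the same [t]; both cancellations are the monoid
   identities evaluated at $(t,x)$. *)
exists (mkcts (@invbinop_section_subproof b^-1%g t)); split.
- exact: cts_fun.
- move=> x; exact: (congr1 (fun g => binop_fun g (t, x)) (invbinop_Vval b)).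
- move=> x; exact: (congr1 (fun g => binop_fun g (t, x)) (invbinop_valV b)).
Qed.

Definition invbinop_homeo (b : invbinop X) (t : X) : G :=
  mkhomeo (@invbinop_section_homeo_subproof b t).

Fact cts_of_invbinop_subproof b : continuous (invbinop_homeo b).
Proof.
apply: continuous_homeo; apply: continuous_comp_initial.
exact: (continuous_curry (@cts_fun _ _ (invbinop_val b))).1.
Qed.

Definition cts_of_invbinop (b : invbinop X) : continuousType X G :=
  mkcts (@cts_of_invbinop_subproof b).

Lemma cts_of_invbinop_continuous : continuous cts_of_invbinop.
Proof.
apply: continuous_comp_initial.
(* Replacing [homeo X] by [X -> X] as target leaves the currying map on $C(X^2,X)$. *)
apply: (compact_open_continuous_initial _ _ _ _ _ _ (@homeo_open_preimage X)).
move=> b; apply: (@continuous_comp _ _ _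
  (fun c : invbinop X => invbinop_val c : X * X -> X)
  (curry : (X * X -> X) -> (X -> X -> X))); last first.
  by apply: curry_continuous => //; exact: cts_fun.
apply: (@continuous_comp _ _ _ (@invbinop_val X)
  (fun c : continuousType (X * X)%type X => c : X * X -> X)).
  exact: initial_continuous.
exact: initial_continuous.
Qed.

Lemma invbinop_of_ctsK : cancel invbinop_of_cts cts_of_invbinop.
Proof. by move=> f; apply/continuousEP => t; exact: homeo_inj. Qed.

Lemma cts_of_invbinopK : cancel cts_of_invbinop invbinop_of_cts.
Proof. by move=> b; apply: invbinop_inj; apply: binop_inj => -[]. Qed.

End exponential_law.

Theorem theorem6 (X : topologicalType)
    (lcX : locally_compact [set: X]) (hX : hausdorff_space X)
    (lcnX : locally_connected X) :
  exists Phi : continuousType X (homeo_topologicalGroup lcX hX lcnX) ->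
               invbinop X,
    {morph Phi : f g / (f * g)%g} /\ homeomorphism Phi.
Proof.
exists (invbinop_of_cts _ lcX hX lcnX); split.
  by move=> f g; apply: invbinop_inj; exact: binop_of_cts_mul.
split; first exact: invbinop_of_cts_continuous.
exists (cts_of_invbinop _ lcX hX lcnX); split.
- exact: cts_of_invbinop_continuous.
- exact: invbinop_of_ctsK.
- exact: cts_of_invbinopK.
Qed.
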